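(* Consider, for $j=1,\ldots,q$, the stochastic Galerkin systems $\hat{\Sigma}_j$: $\hat{E}\dot{\hat{v}}(t)=\hat{A}\hat{v}(t)+\hat{B}u(t)$, $\hat{z}_j(t)=\hat{C}_j\hat{v}(t)$, $t\ge0$, defined in the context, with initial values $\hat{v}(0)=0$ and input $u\in\mathcal{L}^2([0,\infty))^{n_{\rm in}}$. The resulting approximations of the partial variances $\hat{V}_j(t)=\hat{z}_j(t)^\top\hat{z}_j(t)$ satisfy $$\|\hat{V}_j\|_{\mathcal{L}^1([0,\infty))}\le\hat{\theta}_j^2\,\|u\|_{\mathcal{L}^2([0,\infty))}^2$$ for $j=1,\ldots,q$, where $\hat{\theta}_j=\|\hat{\Sigma}_j\|_{\mathcal{L}^2}$ is the $\mathcal{L}^2$ input-output system norm of $\hat{\Sigma}_j$.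
   Context: Parametric system: for $p\in\Pi\subseteq\mathbb{R}^q$ consider $E(p)\dot{x}(t,p)=A(p)x(t,p)+B(p)u(t)$, $y(t,p)=C(p)x(t,p)$, $t\ge0$, with $A(p),E(p)\in\mathbb{R}^{n\times n}$, $B(p)\in\mathbb{R}^{n\times n_{\rm in}}$, $C(p)\in\mathbb{R}^{1\times n}$ depending continuously on $p$, $E(p)$ non-singular, and asymptotically stable for each $p$ (all $\lambda\in\mathbb{C}$ with $\det(\lambda E(p)-A(p))=0$ have negative real part). The parameters are independent random variables with joint probability density $\rho$ on $\Pi$; $\mathbb{E}[f]=\int_\Pi f(p)\rho(p)\,{\rm d}p$ (componentwise for matrices), and $\mathcal{L}^2(\Pi)$ has inner product $\langle f,g\rangle=\mathbb{E}[fg]$. Polynomial basis: $(\Phi_i)_{i\in\mathbb{N}}$ is a complete orthonormal system of $\mathcal{L}^2(\Pi)$ consisting of multivariate polynomials that are products of univariate orthonormal polynomials in $p_1,\ldots,p_q$, ordered such that the total degree satisfies ${\rm degree}(\Phi_i)\le{\rm degree}(\Phi_{i+1})$. For a fixed $d$ let $\mathcal{I}^d=\{i\in\mathbb{N}:{\rm degree}(\Phi_i)\le d\}=\{1,\ldots,m\}$, $m=|\mathcal{I}^d|$, and $\mathcal{I}_j^d=\{i\in\mathcal{I}^d:\Phi_i\text{ is non-constant in }p_j\}$ for $j=1,\ldots,q$. Stochastic Galerkin matrices: with $S(p)=(\Phi_i(p)\Phi_k(p))_{i,k=1,\ldots,m}$ and $s(p)=(\Phi_i(p))_{i=1,\ldots,m}$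 (column vector), set $\hat{A}=\mathbb{E}[S\otimes A]$, $\hat{E}=\mathbb{E}[S\otimes E]\in\mathbb{R}^{mn\times mn}$, $\hat{B}=\mathbb{E}[s\otimes B]\in\mathbb{R}^{mn\times n_{\rm in}}$, $\hat{C}=\mathbb{E}[S\otimes C]\in\mathbb{R}^{m\times mn}$. Standing assumption: $\hat{E}\dot{\hat{v}}=\hat{A}\hat{v}+\hat{B}u$ is an asymptotically stable system of ODEs ($\hat{E}$ non-singular, all $\lambda$ with $\det(\lambda\hat{E}-\hat{A})=0$ have negative real part). The matrix $\hat{C}_j\in\mathbb{R}^{k\times mn}$, $k=|\mathcal{I}_j^d|$, consists of those rows of $\hat{C}$ with index in $\mathcal{I}_j^d$. Thus $\hat{V}_j(t)=\sum_{i\in\mathcal{I}_j^d}\hat{w}_i(t)^2$ with $\hat{w}=\hat{C}\hat{v}$. Norms: $\|x\|_{\mathcal{L}^2([0,\infty))}=\left(\int_0^\infty x(t)^\top x(t)\,{\rm d}t\right)^{1/2}$ for vector-valued $x$, $\|g\|_{\mathcal{L}^1([0,\infty))}=\int_0^\infty|g(t)|\,{\rm d}t$, and $\|\hat{\Sigma}_j\|_{\mathcal{L}^2}=\sup\{\|\hat{z}_j\|_{\mathcal{L}^2([0,\infty))}/\|u\|_{\mathcal{L}^2([0,\infty))}: u\in\mathcal{L}^2([0,\infty))^{n_{\rm in}},\,u\ne0,\,\hat{v}(0)=0\}$. *)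

(* Defs.v *)
From HB Require Import structures.
From mathcomp Require Import all_boot all_order all_algebra.
From mathcomp Require mpoly.
(* The notations of mpoly clash with those of MathComp-Analysis, which must be
   loaded afterwards to shadow mpoly's Measure and isMeasure. *)
Import -(notations) mpoly.
From mathcomp Require Import all_classical all_reals all_analysis.
From mathcomp.real_closed Require Import complex mxtens.

Set Implicit Arguments.
Unset Strict Implicit.
Unset Printing Implicit Defensive.

Import Order.TTheory GRing.Theory Num.Theory.
Import numFieldNormedType.Exports.

Local Open Scope classical_set_scope.
Local Open Scope ring_scope.

(* Lebesgue measure on R^q, with R^q represented by q.-tuple R. *)
Section tuple_lebesgue_measure.
Variable R : realType.

Definition cons_pair (k : nat)
    (x : measurableTypeR R * k.-tuple (measurableTypeR R)) :
  k.+1.-tuple (measurableTypeR R) := [tuple of x.1 :: x.2].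

Lemma measurable_cons_pair (k : nat) :
  measurable_fun [set: measurableTypeR R * k.-tuple (measurableTypeR R)]
    (@cons_pair k).
Proof. exact: measurable_cons measurable_fst measurable_snd. Qed.

Section step.
Variables (k : nat)
  (mu : {sigma_finite_measure set (k.-tuple (measurableTypeR R)) -> \bar R}).

Definition cons_measure : set (k.+1.-tuple (measurableTypeR R)) -> \bar R :=
  pushforward (lebesgue_measure \x mu)%E (@cons_pair k).

Let cons_measure0 : cons_measure set0 = 0%E.
Proof. by rewrite /cons_measure /pushforward preimage_set0 measure0. Qed.

Let cons_measure_ge0 A : (0 <= cons_measure A)%E.
Proof. by apply: measure_ge0; exact: measurable_cons_pair. Qed.

Let cons_measure_sigma_additive : semi_sigma_additive cons_measure.
Proof.
by apply: measure_semi_sigma_additive; exact: measurable_cons_pair.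
Qed.

HB.instance Definition _ := isMeasure.Build _ _ _ cons_measure
  cons_measure0 cons_measure_ge0 cons_measure_sigma_additive.

Let cons_measure_sigma_finite : sigma_finite setT cons_measure.
Proof.
have /sigma_finiteP[F [TF ndF Foo]] := sigma_finiteT (@lebesgue_measure R).
have /sigma_finiteP[G [TG ndG Goo]] := sigma_finiteT mu.
pose H i := [set t : k.+1.-tuple (measurableTypeR R) |
  F i (thead t) /\ G i [tuple of behead t]].
exists H.
  apply/esym; rewrite -subTset => t _.
  have [i _ Fi] : (\bigcup_i F i) (thead t) by rewrite -TF.
  have [j _ Gj] : (\bigcup_i G i) [tuple of behead t] by rewrite -TG.
  exists (maxn i j) => //; split.
    by move: Fi; exact/subsetPset/ndF/leq_maxl.
  by move: Gj; exact/subsetPset/ndG/leq_maxr.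
move=> i; have [mF Fi] := Foo i; have [mG Gi] := Goo i; split.
  apply: measurableI.
    by rewrite -[X in measurable X]setTI; exact: measurable_tnth.
  by rewrite -[X in measurable X]setTI; exact: measurable_behead.
rewrite /cons_measure /pushforward.
rewrite (_ : _ @^-1` _ = F i `*` G i); last first.
  have tlK (x : measurableTypeR R * k.-tuple (measurableTypeR R)) :
    [tuple of behead (cons_pair x)] = x.2 :> k.-tuple (measurableTypeR R).
    exact/val_inj.
  by apply/seteqP; split=> x; rewrite /H /= tlK theadE.
by rewrite product_measure1E// lte_mul_pinfty// ge0_fin_numE.
Qed.

HB.instance Definition _ := Measure_isSigmaFinite.Build _ _ _ cons_measure
  cons_measure_sigma_finite.

End step.

Fixpoint lebesgue_tuple (q : nat) :
    {sigma_finite_measure set (q.-tuple (measurableTypeR R)) -> \bar R} :=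
  if q is k.+1 then cons_measure (lebesgue_tuple k) else \d_ [tuple].

End tuple_lebesgue_measure.

Lemma lebesgue_tuple_box (R : realType) (q : nat)
    (D : 'I_q -> set (measurableTypeR R)) :
  (forall j, measurable (D j)) ->
  (lebesgue_tuple R q [set p | forall j, D j (tnth p j)] =
   \prod_(j < q) lebesgue_measure (D j))%E.
Proof.
elim: q D => [|q IH] D mD.
  by rewrite big_ord0 /= diracE mem_set// => -[].
rewrite big_ord_recl -IH//=.
rewrite /cons_measure /pushforward.
rewrite (_ : _ @^-1` _ =
    D ord0 `*` [set p | forall j, D (lift ord0 j) (tnth p j)]); last first.
  apply/seteqP; split=> -[a t] /= Dat.
    split=> [|j]; first exact: (Dat ord0).
    by have := Dat (lift ord0 j); rewrite /cons_pair tnthS.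
  move=> j; case: (unliftP ord0 j) => [k ->|->]; last exact: Dat.1.
  by rewrite /cons_pair tnthS; exact: Dat.2.
rewrite product_measure1E//.
rewrite (_ : [set _ | _] = \bigcap_(j in setT)
    ((fun p => tnth p j) @^-1` D (lift ord0 j))); last first.
  by apply/seteqP; split=> p /= Dp j; [move=> _|]; exact: Dp.
apply: fin_bigcap_measurable => // j _.
by rewrite -[X in measurable X]setTI; exact: measurable_tnth.
Qed.

Section random_parameters.
Variables (R : realType) (q : nat).
Local Notation params := (q.-tuple (measurableTypeR R)).
Variables (Pi : set params) (rho : params -> R).

Definition probability_density : Prop :=
  [/\ measurable_fun Pi rho,
      forall p, Pi p -> 0 <= rho p &
      (\int[lebesgue_tuple R q]_(p in Pi) (rho p)%:E = 1)%E].

Definition expect (f : params -> R) : R :=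
  \int[lebesgue_tuple R q]_(p in Pi) (f p * rho p).

Definition expect_mx (a b : nat) (M : params -> 'M[R]_(a, b)) : 'M[R]_(a, b) :=
  \matrix_(i, j) expect (fun p => M p i j).

Definition joint_prob (D : set params) : R :=
  \int[lebesgue_tuple R q]_(p in Pi `&` D) rho p.

(* Some of the D j may be the full line, so that all subfamilies are covered. *)
Definition independent_params : Prop :=
  forall D : 'I_q -> set (measurableTypeR R), (forall j, measurable (D j)) ->
    joint_prob [set p | forall j, D j (tnth p j)] =
    \prod_(j < q) joint_prob [set p | D j (tnth p j)].

Definition in_L2 (f : params -> R) : Prop :=
  measurable_fun Pi f /\
  (\int[lebesgue_tuple R q]_(p in Pi) (f p ^+ 2 * rho p)%:E < +oo)%E.

Definition tuple_of_row (x : 'rV[R]_q) : params := [tuple x 0 j | j < q].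

(* R^q carries its topology as 'rV[R]_q and its sigma-algebra as a tuple type. *)
Definition continuous_on_params (a b : nat) (M : params -> 'M[R]_(a, b)) : Prop :=
  {within tuple_of_row @^-1` Pi, continuous (M \o tuple_of_row)}.

Definition mpoly_fun (P : mpoly q R) (p : params) : R := meval (tnth p) P.

Definition total_degree (P : mpoly q R) : nat := (msize P).-1.

(* Some monomial of P contains the j-th variable. *)
Definition nonconstant_in (j : 'I_q) (P : mpoly q R) : bool :=
  has (fun mu : multinom q => mu j != 0%N) (msupp P).

Definition univariate (j : 'I_q) (f : {poly R}) : mpoly q R :=
  (map_poly (@mpolyC q R) f).[mpolyX R (mnm1 j)].

Definition orthonormal_univariate (j : 'I_q) (phi : nat -> {poly R}) : Prop :=
  forall k l : nat,
    expect (fun p => (phi k).[tnth p j] * (phi l).[tnth p j]) = (k == l)%:R.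

Definition product_basis (Phi : nat -> mpoly q R) : Prop :=
  exists2 phi : 'I_q -> nat -> {poly R},
    (forall j, orthonormal_univariate j (phi j)) &
    forall i, exists alpha : 'I_q -> nat,
      Phi i = \prod_(j < q) univariate j (phi j (alpha j)).

(* Complete: only the zero element of L2 is orthogonal to every Phi i; f vanishes
   in L2 iff f * rho = 0 almost everywhere on Pi. *)
Definition complete_orthonormal (Phi : nat -> mpoly q R) : Prop :=
  [/\ forall i, in_L2 (mpoly_fun (Phi i)),
      forall i k, expect (fun p => mpoly_fun (Phi i) p * mpoly_fun (Phi k) p) =
                  (i == k)%:R &
      forall f, in_L2 f ->
        (forall i, expect (fun p => f p * mpoly_fun (Phi i) p) = 0) ->
        {ae lebesgue_tuple R q, forall p, Pi p -> f p * rho p = 0}].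

Definition polynomial_basis (Phi : nat -> mpoly q R) : Prop :=
  [/\ complete_orthonormal Phi, product_basis Phi &
      forall i, (total_degree (Phi i) <= total_degree (Phi i.+1))%N].

End random_parameters.

(* The basis is indexed from 0, so that the degree-d index set is 'I_m. *)
Section galerkin.
Variables (R : realType) (q n nin m : nat).
Local Notation params := (q.-tuple (measurableTypeR R)).
Variables (Pi : set params) (rho : params -> R) (Phi : nat -> mpoly q R).

Definition basis_col (p : params) : 'cV[R]_m := \col_(i < m) mpoly_fun (Phi i) p.

Definition basis_mx (p : params) : 'M[R]_m :=
  \matrix_(i < m, k < m) (mpoly_fun (Phi i) p * mpoly_fun (Phi k) p).

Definition galerkin_sq (A : params -> 'M[R]_n) : 'M[R]_(m * n) :=
  expect_mx Pi rho (fun p => tensmx (basis_mx p) (A p)).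

Definition galerkin_in (B : params -> 'M[R]_(n, nin)) : 'M[R]_(m * n, nin) :=
  castmx (erefl, mul1n nin)
    (expect_mx Pi rho (fun p => tensmx (basis_col p) (B p))).

Definition galerkin_out (C : params -> 'rV[R]_n) : 'M[R]_(m, m * n) :=
  castmx (muln1 m, erefl)
    (expect_mx Pi rho (fun p => tensmx (basis_mx p) (C p))).

Definition partial_index (j : 'I_q) : {set 'I_m} :=
  [set i : 'I_m | nonconstant_in j (Phi i)].

Definition galerkin_out_part (C : params -> 'rV[R]_n) (j : 'I_q) :
    'M[R]_(#|partial_index j|, m * n) :=
  rowsub (fun r => enum_val r) (galerkin_out C).

End galerkin.

Section linear_systems.
Variable R : realType.

Definition asymptotically_stable (N : nat) (E A : 'M[R]_N) : Prop :=
  E \in unitmx /\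
  forall lambda : R[i],
    \det (lambda *: map_mx (real_complex R) E - map_mx (real_complex R) A) = 0 ->
    complex.Re lambda < 0.

Local Notation leb := (@lebesgue_measure R).
Local Notation halfline := (`[0, +oo[%classic : set (measurableTypeR R)).

Definition L1norm (g : R -> R) : \bar R :=
  (\int[leb]_(t in halfline) `|(g t)%:E|)%E.

Definition L2norm (k : nat) (x : R -> 'cV[R]_k) : \bar R :=
  sqrte (\int[leb]_(t in halfline) (((x t)^T *m x t) 0 0)%:E)%E.

Definition L2signal (k : nat) (x : R -> 'cV[R]_k) : Prop :=
  (forall i, measurable_fun halfline (fun t => x t i 0)) /\ (L2norm x < +oo)%E.

Definition nonzero_signal (k : nat) (x : R -> 'cV[R]_k) : Prop :=
  ~ {ae leb, forall t, 0 <= t -> x t = 0}.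

(* Lebesgue's characterization of locally absolutely continuous functions. *)
Definition loc_abs_continuous (f : R -> R) : Prop :=
  {ae leb, forall t, 0 <= t -> derivable f t 1} /\
  forall T, 0 <= T ->
    leb.-integrable `[0, T] (EFin \o derive1 f) /\
    f T = f 0 + \int[leb]_(t in `[0, T]) derive1 f t.

Definition derive_col (N : nat) (v : R -> 'cV[R]_N) (t : R) : 'cV[R]_N :=
  \col_i derive1 (fun s => v s i 0) t.

(* Solutions in the sense of Caratheodory, as the input is only in L^2; the
   values of v and u at negative times are irrelevant. *)
Definition is_solution (N nin : nat) (E A : 'M[R]_N) (B : 'M[R]_(N, nin))
    (u : R -> 'cV[R]_nin) (v : R -> 'cV[R]_N) : Prop :=
  (forall i, loc_abs_continuous (fun t => v t i 0)) /\
  {ae leb, forall t, 0 <= t -> E *m derive_col v t = A *m v t + B *m u t}.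

(* Extended real: for an asymptotically stable system the supremum is finite. *)
Definition system_norm (N nin k : nat) (E A : 'M[R]_N) (B : 'M[R]_(N, nin))
    (C : 'M[R]_(k, N)) : \bar R :=
  ereal_sup [set r : \bar R | exists u v,
    [/\ L2signal u, nonzero_signal u, is_solution E A B u v, v 0 = 0 &
        r = (L2norm (fun t => C *m v t) / L2norm u)%E]].

End linear_systems.

(* Main.v *)
(** Since V_j = z_j^T z_j, the L1 norm of V_j is the square of the L2 norm of
    z_j. If u does not vanish almost everywhere, then |z_j|_2 / |u|_2 is one of
    the ratios over which the system norm is the supremum. If u vanishes almost
    everywhere, then v solves a homogeneous linear ODE with v(0) = 0 in the
    sense of Caratheodory, so v = 0 by a contraction estimate on successive
    short intervals. *)
Require Import Defs.
From HB Require Import structures.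
From mathcomp Require Import all_boot all_order all_algebra.
From mathcomp Require mpoly.
From mathcomp Require Import all_classical all_reals all_analysis.
From mathcomp.real_closed Require Import complex mxtens.
From mathcomp Require Import lra.
Import Order.TTheory GRing.Theory Num.Theory.
Import numFieldNormedType.Exports.

Local Open Scope classical_set_scope.
Local Open Scope ring_scope.

(** A mean value inequality that tolerates a null set of exceptional points: subtracting the
    integral representations of [f] at [t] and at [a] writes the increment as the integral of [f']
    over the half-open interval between them. *)
Lemma loc_abs_continuous_increment (R : realType) (f : R -> R) (c a t : R) :
  loc_abs_continuous f -> 0 <= a <= t -> 0 <= c ->
  {ae @lebesgue_measure R, forall s, a <= s <= t -> `|derive1 f s| <= c} ->
  `|f t - f a| <= c * (t - a).
Proof.
move=> [_ lacf] /andP[a0 at_] c0 f'c.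
have [fa fE] := lacf a a0; have [ft ftE] := lacf t (le_trans a0 at_).
have fat : f t - f a = \int[lebesgue_measure]_(s in `]a, t]) derive1 f s.
  by rewrite ftE fE opprD addrACA subrr add0r Rintegral_itvB// bnd_simp.
have iat : (@lebesgue_measure R).-integrable `]a, t] (EFin \o derive1 f).
  by apply: integrableS ft => //; apply: subset_itv; rewrite bnd_simp.
have mat := measurable_int _ iat.
rewrite fat -lee_fin /Rintegral -abse_EFin fineK;
  last exact: integrable_fin_num.
apply: le_trans (le_abse_integral _ _ mat) _ => //.
apply: (@le_trans _ _ (c%:E * lebesgue_measure `]a, t])%E); last first.
  by rewrite lebesgue_measure_itv/= lte_fin; case: ltgtP at_ => [_|//|->] _;
     rewrite ?subrr ?mule0 ?mulr0// -EFinM.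
apply: integral_le_bound => //.
move: f'c; apply: filterS;
    first exact: (ae_filter_ringOfSetsType lebesgue_measure).
move=> s f'c; rewrite /= in_itv/= => /andP[/ltW as_ st].
by rewrite lee_fin f'c// as_ st.
Qed.

(** Makes the supremum in the contraction argument finite. The bound is [|f 0|] plus the integral of
    [|f'|] over the whole of [[0, T]]. *)
Lemma loc_abs_continuous_bounded (R : realType) (f : R -> R) (T : R) :
  loc_abs_continuous f -> 0 <= T ->
  exists c, forall t, 0 <= t <= T -> `|f t| <= c.
Proof.
move=> [_ lacf] T0; have [iT _] := lacf T T0.
exists (`|f 0| + \int[lebesgue_measure]_(s in `[0, T]) `|derive1 f s|).
move=> t /andP[t0 tT]; have [it ->] := lacf t t0.
apply: le_trans (ler_normD _ _) _; rewrite lerD2l.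
apply: le_trans (le_normr_Rintegral _ _) _ => //.
have sub : `[0, t] `<=` `[0, T] by apply: subset_itvl; rewrite bnd_simp.
have iTn : (@lebesgue_measure R).-integrable `[0, T]
  (fun s => `|derive1 f s|%:E) by exact: integrable_norm iT.
rewrite /Rintegral fine_le//; try exact: integrable_fin_num.
  by apply: integrable_fin_num => //; exact: integrableS iTn.
by apply: ge0_subset_integral => //; exact: measurable_int iTn.
Qed.

(** With S the supremum norm of [v] on [[a, b]], almost every derivative of a coordinate is at most
    K * S, so increments from [v a = 0] are at most K * (b - a) * S, hence at most S / 2. As S is
    finite, it vanishes. *)
Lemma linear_ode_local_uniqueness (R : realType) (N : nat) (M : 'M[R]_N)
    (v : R -> 'cV[R]_N) (a b : R) :
  (forall i, loc_abs_continuous (fun t => v t i 0)) ->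
  {ae @lebesgue_measure R, forall t, 0 <= t -> derive_col v t = M *m v t} ->
  0 <= a -> v a = 0 -> (b - a) * (\sum_i \sum_j `|M i j|) <= 2^-1 ->
  forall t, a <= t <= b -> v t = 0.
Proof.
move=> lacv v' a0 va0; set K := \sum_i _ => bK t atb.
have K0 : 0 <= K by apply: sumr_ge0 => i _; exact: sumr_ge0.
have [at_ tb] := andP atb; have ab := le_trans at_ tb.
apply/matrixP => i j; rewrite mxE ord1 {j}; apply/eqP; rewrite -normr_le0.
(* [sup X] is the supremum norm over all coordinates and times at once. It is meaningful only once
   [X] is known to be bounded. *)
pose X := [set r | exists k s, a <= s <= b /\ r = `|v s k 0|].
have Xub : has_ubound X.
  have /choice[c vc] (k : 'I_N) :=
    loc_abs_continuous_bounded _ _ _ (lacv k) (le_trans a0 ab).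
  exists (\sum_k `|c k|) => _ [k [s [/andP[as_ sb] ->]]].
  rewrite (bigD1 k)//= ler_wpDr ?sumr_ge0//.
  by rewrite (le_trans _ (ler_norm _))// vc// sb (le_trans a0 as_).
have X_le k s : a <= s <= b -> `|v s k 0| <= sup X.
  by move=> asb; apply: ub_le_sup => //; exists k, s.
have S0 : 0 <= sup X by rewrite (le_trans _ (X_le i t atb)).
(* Integrating the equation halves any bound valid on the short interval. *)
suff : sup X <= 2^-1 * sup X by have := X_le i t atb; lra.
apply: ge_sup => [|_ [k [s [asb ->]]]]; first by exists `|v t i 0|, i, t.
have [as_ sb] := andP asb.
have -> : v s k 0 = v s k 0 - v a k 0 by rewrite va0 mxE subr0.
apply: (@le_trans _ _ (K * sup X * (s - a))).
  apply: (@loc_abs_continuous_increment _ (fun t => v t k 0)) => //.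
  - by rewrite a0.
  - exact: mulr_ge0.
  move: v'; apply: filterS;
    first exact: (ae_filter_ringOfSetsType lebesgue_measure).
move=> r /[swap] /andP[ar rs] /(_ (le_trans a0 ar)).
  move=> /matrixP/(_ k 0); rewrite mxE => ->; rewrite mxE.
  apply: le_trans (ler_norm_sum _ _ _) _.
  (* Row [k] alone bounds this derivative; the other rows in [K] add nonnegative terms and make the
     constant independent of [k]. *)
  rewrite /K mulr_suml [leRHS](bigD1 k)//= ler_wpDr//.
    by apply: sumr_ge0 => l _; rewrite mulr_ge0// sumr_ge0.
  rewrite mulr_suml ler_sum// => l _; rewrite normrM ler_wpM2l// X_le//.
  by rewrite ar (le_trans rs sb).
rewrite mulrAC ler_wpM2r// (le_trans _ bK)// mulrC ler_wpM2r//; lra.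
Qed.

(** The admissible interval length depends on [M] alone, so steps of one fixed length [e] propagate
    the zero value along the half-line. *)
Lemma linear_ode_uniqueness (R : realType) (N : nat) (M : 'M[R]_N)
    (v : R -> 'cV[R]_N) :
  (forall i, loc_abs_continuous (fun t => v t i 0)) ->
  {ae @lebesgue_measure R, forall t, 0 <= t -> derive_col v t = M *m v t} ->
  v 0 = 0 -> forall t, 0 <= t -> v t = 0.
Proof.
move=> lacv v' v0 t t0; set K := \sum_i \sum_j `|M i j|.
have K0 : 0 <= K by apply: sumr_ge0 => i _; exact: sumr_ge0.
(* Adding 1 to [K] keeps the denominator positive when [M = 0]. *)
pose e := (2 * (K + 1))^-1.
have e0 : 0 < e by rewrite invr_gt0; lra.
have eK : e * K <= 2^-1.
  by rewrite mulrC ler_pdivrMr; lra.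
suff vk k s : 0 <= s <= k%:R * e -> v s = 0.
  (* Archimedean step: this many intervals of length [e] reach beyond [t]. *)
  apply: (vk (Num.trunc (t / e)).+1); rewrite t0/= -ler_pdivrMr// ltW//.
  exact: truncnS_gt.
elim: k s => [|k IH] s.
  by rewrite mul0r => /andP[s0 sle]; rewrite (@le_anti _ _ s 0)// s0 sle.
move=> /andP[s0 sk]; have [sk'|ks] := leP s (k%:R * e); first by rewrite IH ?s0.
have ke0 : 0 <= k%:R * e by rewrite mulr_ge0// ltW.
apply: (@linear_ode_local_uniqueness _ _ M v (k%:R * e) (k.+1%:R * e)) => //.
- by rewrite IH// ke0 lexx.
- by rewrite -mulrBl -natrB// subSnn mul1r.
- by rewrite (ltW ks).
Qed.

Lemma normsq_col (R : realType) (k : nat) (x : 'cV[R]_k) :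
  (x^T *m x) 0 0 = \sum_i x i 0 ^+ 2.
Proof. by rewrite mxE; apply: eq_bigr => i _; rewrite mxE expr2. Qed.

Lemma normsq_col_ge0 (R : realType) (k : nat) (x : 'cV[R]_k) :
  0 <= (x^T *m x) 0 0.
Proof. by rewrite normsq_col sumr_ge0// => i _; exact: sqr_ge0. Qed.

Lemma L2norm_sqr (R : realType) (k : nat) (x : R -> 'cV[R]_k) :
  (L2norm x ^+ 2)%E = L1norm (fun t => ((x t)^T *m x t) 0 0).
Proof.
rewrite /L2norm sqr_sqrte; last first.
  by apply: integral_ge0 => t _; rewrite lee_fin normsq_col_ge0.
by apply: eq_integral => t _; rewrite gee0_abs// lee_fin normsq_col_ge0.
Qed.

(** A nonnegative function with zero integral vanishes almost everywhere, and a zero sum of squares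
    kills every coordinate. This legitimates division by [L2norm u]. *)
Lemma L2norm_gt0 (R : realType) (k : nat) (u : R -> 'cV[R]_k) :
  L2signal u -> nonzero_signal u -> (0 < L2norm u)%E.
Proof.
move=> [mu _] nzu; rewrite lt0e sqrte_ge0 andbT; apply/eqP => u0; apply: nzu.
have : L1norm (fun t => ((u t)^T *m u t) 0 0) = 0%E.
  by rewrite -L2norm_sqr u0 expe2 mule0.
have mu2 : measurable_fun (`[0, +oo[%classic : set (measurableTypeR R))
    (fun t => ((u t)^T *m u t) 0 0).
  under [X in measurable_fun _ X]eq_fun do rewrite normsq_col.
  by apply: measurable_sum => i;
     exact: measurable_realfun.measurable_funX.
move: mu2 => /measurable_realfun.measurable_EFinP mu2.
move=> /(proj1 (ae_eq_integral_abs lebesgue_measure (measurable_itv _) mu2)).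
apply: filterS => t ut t0.
have /ut[] : `[0, +oo[%classic t by rewrite /= in_itv/= t0.
move=> /eqP; rewrite normsq_col psumr_eq0 => [/allP ui0|i _];
  last exact: sqr_ge0.
apply/matrixP => i j; rewrite ord1 mxE; apply/eqP.
by have := ui0 i (mem_index_enum _); rewrite /= sqrf_eq0.
Qed.

Lemma L2norm_output_le (R : realType) (N nin k : nat) (E A : 'M[R]_N)
    (B : 'M[R]_(N, nin)) (C : 'M[R]_(k, N))
    (u : R -> 'cV[R]_nin) (v : R -> 'cV[R]_N) :
  L2signal u -> nonzero_signal u -> is_solution E A B u v -> v 0 = 0 ->
  (L2norm (fun t => C *m v t) <= system_norm E A B C * L2norm u)%E.
Proof.
move=> L2u nzu sol v0; have u0 := L2norm_gt0 _ _ _ L2u nzu.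
have uoo : (L2norm u < +oo)%E by case: L2u.
have /(ereal_sup_ubound) : [set r : \bar R | exists u v,
    [/\ L2signal u, nonzero_signal u, is_solution E A B u v, v 0 = 0 &
        r = (L2norm (fun t => C *m v t) / L2norm u)%E]]
    (L2norm (fun t => C *m v t) / L2norm u)%E by exists u, v.
rewrite -/(system_norm E A B C).
(* Positivity and finiteness leave a positive real [r], by which an extended real inequality can be
   multiplied. *)
move: u0 uoo; case: (L2norm u) => // r; rewrite lte_fin => r0 _.
by rewrite inver gt_eqF// lee_pdivrMr.
Qed.

Lemma sqr_output_bound (R : realType) (N nin k : nat) (E A : 'M[R]_N)
    (B : 'M[R]_(N, nin)) (C : 'M[R]_(k, N))
    (u : R -> 'cV[R]_nin) (v : R -> 'cV[R]_N) :
  E \in unitmx -> L2signal u -> is_solution E A B u v -> v 0 = 0 ->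
  (L1norm (fun t => ((C *m v t)^T *m (C *m v t)) 0%R 0%R) <=
   system_norm E A B C ^+ 2 * L2norm u ^+ 2)%E.
Proof.
move=> Eu L2u sol v0; have [nzu|/contrapT u0] := pselect (nonzero_signal u).
  have zle := L2norm_output_le _ _ _ _ _ _ _ C _ _ L2u nzu sol v0.
  rewrite -L2norm_sqr !expe2 muleACA.
  by apply: lee_pmul => //; exact: sqrte_ge0.
have v_eq0 : forall t, 0 <= t -> v t = 0.
  (* With [u = 0] almost everywhere, inverting [E] yields v' = E^-1 A v. *)
  apply: (@linear_ode_uniqueness _ _ (invmx E *m A) v) => //.
    by case: sol.
  case: sol u0 => _; apply: filterS2;
    first exact: (ae_filter_ringOfSetsType lebesgue_measure).
  move=> t sol u0 t0.
  by have := sol t0; rewrite u0// mulmx0 addr0 -mulmxA => <-;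
     rewrite mulKmx.
have -> : L1norm (fun t => ((C *m v t)^T *m (C *m v t)) 0 0) = 0%E.
  apply: integral0_eq => t; rewrite /= in_itv/= andbT => t0.
  by rewrite v_eq0// !mulmx0 mxE normr0.
rewrite mule_ge0//; last by rewrite expe_ge0// sqrte_ge0.
(* The norm may be negative here: if no nonzero input exists, as for [nin = 0], it is the supremum
   of the empty set, [-oo]. Its square is nonnegative in either case. *)
rewrite expe2; case: (leP 0 (system_norm E A B C))%E => [|/ltW] ?.
  exact: mule_ge0.
exact: mule_le0.
Qed.

Theorem lemma2 (R : realType) (q n nin d m : nat)
  (Pi : set (q.-tuple (measurableTypeR R)))
  (rho : q.-tuple (measurableTypeR R) -> R)
  (A E : q.-tuple (measurableTypeR R) -> 'M[R]_n)
  (B : q.-tuple (measurableTypeR R) -> 'M[R]_(n, nin))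
  (C : q.-tuple (measurableTypeR R) -> 'rV[R]_n)
  (Phi : nat -> mpoly.mpoly q R)
  (mPi : measurable Pi)
  (contA : continuous_on_params Pi A)
  (contE : continuous_on_params Pi E)
  (contB : continuous_on_params Pi B)
  (contC : continuous_on_params Pi C)
  (stable : forall p, Pi p -> asymptotically_stable (E p) (A p))
  (density : probability_density Pi rho)
  (indep : independent_params Pi rho)
  (basis : polynomial_basis Pi rho Phi)
  (hm : forall i : nat, (total_degree (Phi i) <= d)%N = (i < m)%N)
  (stableG : asymptotically_stable (galerkin_sq m Pi rho Phi E)
                                   (galerkin_sq m Pi rho Phi A)) :
  forall (j : 'I_q) (u : R -> 'cV[R]_nin) (v : R -> 'cV[R]_(m * n)),
    let Ahat := galerkin_sq m Pi rho Phi A in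
    let Ehat := galerkin_sq m Pi rho Phi E in
    let Bhat := galerkin_in m Pi rho Phi B in
    let Chat_j := galerkin_out_part m Pi rho Phi C j in
    let z_j t := Chat_j *m v t in
    let V_j t := ((z_j t)^T *m z_j t) 0 0 in
    let theta_j := system_norm Ehat Ahat Bhat Chat_j in
    L2signal u ->
    is_solution Ehat Ahat Bhat u v ->
    v 0 = 0 ->
    (L1norm V_j <= theta_j ^+ 2 * L2norm u ^+ 2)%E.
Proof.
move=> j u v Ahat Ehat Bhat Chat_j z_j V_j theta_j L2u sol v0.
by apply: sqr_output_bound => //; case: stableG.
Qed.
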